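(* Let $u^{\mathcal{N}}_M(\boldsymbol{x},\boldsymbol{\mu})=\sum_{m=1}^M\widehat{u}^{\mathcal{N}}_m(\boldsymbol{x})\Phi_m(\boldsymbol{\mu})$ be the truth gPC approximation and $u^{N}_M(\boldsymbol{x},\boldsymbol{\mu})=\sum_{m=1}^M\widehat{u}^{N}_m(\boldsymbol{x})\Phi_m(\boldsymbol{\mu})$ the RBM-gPC approximation built from an $N$-dimensional reduced basis approximation $u^N$, where $\widehat{u}^{\mathcal{N}}_m=\sum_{q=1}^Q w_q u^{\mathcal{N}}(\cdot,\boldsymbol{\mu}^q)\Phi_m(\boldsymbol{\mu}^q)$ and $\widehat{u}^{N}_m=\sum_{q=1}^Q w_q u^{N}(\cdot,\boldsymbol{\mu}^q)\Phi_m(\boldsymbol{\mu}^q)$ for a quadrature rule $\{\boldsymbol{\mu}^q,w_q\}_{q=1}^Q$ with real weights. Assume the a posteriori estimate $\Delta_N$ satisfies $\Delta_N(\boldsymbol{\mu}^q)\ge\|u^{\mathcal{N}}(\cdot,\boldsymbol{\mu}^q)-u^N(\cdot,\boldsymbol{\mu}^q)\|_{X_{\mathcal{N}}}$ for $q=1,\dots,Q$, and put $\Delta^w_N(\boldsymbol{\mu}^q)=\Delta_N(\boldsymbol{\mu}^q)\sqrt{Q|w_q|}$. Let $\mathcal{F}$ be a quantity of interest map and $V\subset X_{\mathcal{N}}$ a set containing all the coefficients $\widehat{u}^{\mathcal{N}}_m,\widehat{u}^N_m$ ($1\le m\le M$) such that, for some map $\theta_{\mathcal{F}}:V\to X_{\mathcal{N}}$,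 (i) $\mathcal{F}\left[\sum_{m=1}^M v_m(\boldsymbol{x})\Phi_m(\boldsymbol{\mu})\right]=\sum_{m=1}^M\theta_{\mathcal{F}}(v_m)\,\mathcal{F}[\Phi_m(\boldsymbol{\mu})]$ for all $v_1,\dots,v_M\in V$, where $\mathcal{F}[\Phi_m(\boldsymbol{\mu})]\in\mathbb{R}$; (ii) $\|\theta_{\mathcal{F}}(v)-\theta_{\mathcal{F}}(w)\|_{X_{\mathcal{N}}}\le C_{\mathrm{Lip}}\|v-w\|_{X_{\mathcal{N}}}$ for all $v,w\in V$. Then $$\left\|\mathcal{F}[u^N_M]-\mathcal{F}[u^{\mathcal{N}}_M]\right\|_{X_{\mathcal{N}}}\le C_{\mathrm{Lip}}\,C_{Q,M}\sqrt{\frac1Q\sum_{q=1}^Q\left[\Delta^w_N(\boldsymbol{\mu}^q)\right]^2},$$ where $$C_{Q,M}=\sum_{m=1}^M B_{Q,m}\left|\mathcal{F}[\Phi_m(\boldsymbol{\mu})]\right|,\qquad B_{Q,m}=\sqrt{\sum_{q=1}^Q|w_q|\,\Phi_m^2(\boldsymbol{\mu}^q)}.$$ (The constant $C_{Q,M}$ is independent of the solution.)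
   Context: Parameters: $\boldsymbol{\mu}=(\mu_1,\dots,\mu_K)$ is a random vector with mutually independent components, $\mu_i$ having image $\Gamma_i\subset\mathbb{R}$, probability density $\rho_i$ and finite moments of all orders; $\boldsymbol{\Gamma}=\Gamma_1\times\cdots\times\Gamma_K$ and $\rho(\boldsymbol{\mu})=\prod_i\rho_i(\mu_i)$. For each $i$, $\{\phi^{(i)}_n\}_{n\ge0}$ are the orthonormal polynomials for $\rho_i$ ($\deg\phi^{(i)}_n=n$), and $\Phi_\alpha(\boldsymbol{\mu})=\prod_{k=1}^K\phi^{(k)}_{\alpha_k}(\mu_k)$ for $\alpha\in\mathbb{N}_0^K$. The functions $\Phi_1,\dots,\Phi_M$, with $M=\binom{K+P}{K}$, enumerate the $\Phi_\alpha$ with $|\alpha|=\sum_k\alpha_k\le P$, in an ordering nondecreasing in $|\alpha|$. The quadrature rule is meant to approximate $\int_{\boldsymbol{\Gamma}}f\rho\,d\boldsymbol{\mu}\approx\sum_q w_q f(\boldsymbol{\mu}^q)$. Truth solution: $X_{\mathcal{N}}$ is a real Hilbert space of dimension $\mathcal{N}$ (a discretized space of functions of the spatial variable $\boldsymbol{x}\in D$) with norm $\|\cdot\|_{X_{\mathcal{N}}}$. For each $\boldsymbol{\mu}\in\boldsymbol{\Gamma}$, $u^{\mathcal{N}}(\cdot,\boldsymbol{\mu})\in X_{\mathcal{N}}$ is the unique solution of a discretized linear PDE $\mathcal{L}^{\mathcal{N}}(\boldsymbol{\mu})u^{\mathcal{N}}(\cdot,\boldsymbol{\mu})=f^{\mathcal{N}}(\boldsymbol{\mu})$,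 with $\mathcal{L}^{\mathcal{N}}(\boldsymbol{\mu})$ an invertible linear operator (identified with its matrix). Reduced basis approximation: given $\boldsymbol{\nu}^1,\dots,\boldsymbol{\nu}^N$ in the training set $\Xi=\{\boldsymbol{\mu}^q\}_{q=1}^Q$, set $X^N=\mathrm{span}\{u^{\mathcal{N}}(\cdot,\boldsymbol{\nu}^k)\}_{k=1}^N\subset X_{\mathcal{N}}$. For each $\boldsymbol{\mu}$, $u^N(\cdot,\boldsymbol{\mu})=\sum_{k=1}^N c_k(\boldsymbol{\mu})u^{\mathcal{N}}(\cdot,\boldsymbol{\nu}^k)\in X^N$, where the real coefficients $c_k(\boldsymbol{\mu})$ are determined by $\mathcal{P}\big[\sum_k c_k(\boldsymbol{\mu})\mathcal{L}^{\mathcal{N}}(\boldsymbol{\mu})u^{\mathcal{N}}(\cdot,\boldsymbol{\nu}^k)\big]=\mathcal{P}[f^{\mathcal{N}}(\boldsymbol{\mu})]$ for a chosen projection operator $\mathcal{P}$ (e.g. least squares). A posteriori estimate: $\Delta_N(\boldsymbol{\mu})=\|R_N(\cdot,\boldsymbol{\mu})\|_{X_{\mathcal{N}}}/\sqrt{\beta_{LB}(\boldsymbol{\mu})}$, where $R_N(\cdot,\boldsymbol{\mu})$ is (the Riesz representation of) the residual $f^{\mathcal{N}}(\boldsymbol{\mu})-\mathcal{L}^{\mathcal{N}}(\boldsymbol{\mu})u^N(\cdot,\boldsymbol{\mu})$ and $0<\beta_{LB}(\boldsymbol{\mu})\le\min_{v\ne0}\frac{v^T\mathcal{L}^{\mathcal{N}}(\boldsymbol{\mu})^T\mathcal{L}^{\mathcal{N}}(\boldsymbol{\mu})v}{\|v\|^2_{X_{\mathcal{N}}}}$.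 The standing assumption is that this estimate is rigorous, i.e. $\Delta_N(\boldsymbol{\mu})\ge\|u^{\mathcal{N}}(\cdot,\boldsymbol{\mu})-u^N(\cdot,\boldsymbol{\mu})\|_{X_{\mathcal{N}}}$ for all $\boldsymbol{\mu}\in\Xi$; this is the only property of $\Delta_N$ that matters for the claim. Quantity of interest: $\mathcal{F}$ maps $M$-term gPC expansions $\sum_m v_m(\boldsymbol{x})\Phi_m(\boldsymbol{\mu})$ with $v_m\in V$ to elements of $X_{\mathcal{N}}$, and scalar polynomials $\Phi_m(\boldsymbol{\mu})$ to real numbers. Examples: expectation in $\boldsymbol{\mu}$ ($\theta_{\mathcal{F}}(v)=v$), variance or squared $L^2_\rho$-norm in $\boldsymbol{\mu}$ ($\theta_{\mathcal{F}}(v)=v^2$). *)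

(* Defs.v *)
From HB Require Import structures.
From mathcomp Require Import all_boot all_order all_algebra.
From mathcomp Require Import all_classical all_reals all_analysis.

Set Implicit Arguments.
Unset Strict Implicit.
Unset Printing Implicit Defensive.

Import Order.TTheory GRing.Theory Num.Theory.
Local Open Scope classical_set_scope.
Local Open Scope ring_scope.

Section RandomParameters.
Context {R : realType} {disp : measure_display} {Omega : measurableType disp}.
Variables (Pr : probability Omega R) (K : nat) (mu : 'I_K -> {RV Pr >-> R}).

Definition mutually_independent : Prop :=
  forall (J : {set 'I_K}) (A : 'I_K -> set R),
    (forall i, measurable (A i)) ->
    Pr (\bigcap_(i in [set i | i \in J]) (mu i @^-1` A i)) =
    (\prod_(i in J) Pr (mu i @^-1` A i))%E.

Definition has_density (i : 'I_K) (rho : R -> R) : Prop :=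
  [/\ measurable_fun setT rho,
      forall x, 0 <= rho x &
      forall A, measurable A ->
        distribution Pr (mu i) A =
        (\int[lebesgue_measure]_(x in A) (rho x)%:E)%E].

Definition finite_moments (i : 'I_K) : Prop :=
  forall n, Pr.-integrable setT (fun om => (mu i om ^+ n)%:E).

(* The box Gamma = Gamma_1 x ... x Gamma_K, Gamma_i being the image of mu_i. *)
Definition param_domain : set 'rV[R]_K :=
  [set y | forall i, range (mu i) (y 0 i)].

End RandomParameters.

Section PolynomialChaos.
Context {R : realType}.

(* The density already carries all its mass on the image of the random
   variable, so the integrals are taken over the whole line. *)
Definition orthonormal_polys (rho : R -> R) (phi : nat -> {poly R}) : Prop :=
  (forall n, size (phi n) = n.+1) /\
  (forall n p,
    (\int[lebesgue_measure]_x ((phi n).[x] * (phi p).[x] * rho x)%:E =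
     ((n == p)%:R)%:E)%E).

Definition multi_degree (K : nat) (a : {ffun 'I_K -> nat}) : nat :=
  (\sum_(k < K) a k)%N.

(* m |-> alpha m lists the multi-indices of total degree at most p, each one
   once, in an order along which the total degree does not decrease. *)
Definition graded_enumeration (K p M : nat)
    (alpha : 'I_M -> {ffun 'I_K -> nat}) : Prop :=
  [/\ injective alpha,
      forall a, (multi_degree a <= p)%N <-> exists m, alpha m = a &
      forall m m' : 'I_M, (m <= m')%N ->
        (multi_degree (alpha m) <= multi_degree (alpha m'))%N].

Definition gpc_basis (K M : nat) (phi : 'I_K -> nat -> {poly R})
    (alpha : 'I_M -> {ffun 'I_K -> nat}) (m : 'I_M) (y : 'rV[R]_K) : R :=
  \prod_(k < K) (phi k (alpha m k)).[y 0 k].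

Context {X : vectType R} {K M : nat}.

Definition gpc_expansion (Phi : 'I_M -> 'rV[R]_K -> R) (v : 'I_M -> X) :
    'rV[R]_K -> X :=
  fun y => \sum_(m < M) Phi m y *: v m.

Definition gpc_coef (Q : nat) (node : 'I_Q -> 'rV[R]_K) (w : 'I_Q -> R)
    (Phi : 'I_M -> 'rV[R]_K -> R) (u : 'rV[R]_K -> X) (m : 'I_M) : X :=
  \sum_(q < Q) (w q * Phi m (node q)) *: u (node q).

(* A quantity of interest acts on X-valued expansions and on scalar
   polynomials.  Both maps are total; their values outside these arguments
   are never used. *)
Record quantity_of_interest := QuantityOfInterest {
  qoi_vec : ('rV[R]_K -> X) -> X;
  qoi_scal : ('rV[R]_K -> R) -> R }.

End PolynomialChaos.

Arguments quantity_of_interest {R} X K.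

Section Truth.
Context {R : realType} {X : vectType R}.

Definition hnorm (ip : {dot X for idfun}) (v : X) : R := Num.sqrt (ip v v).

Context {dimX : nat}.

Definition dofs (e : dimX.-tuple X) (v : X) : 'cV[R]_dimX :=
  \col_i coord e i v.

Definition op_matrix (e : dimX.-tuple X) (A : 'End(X)) : 'M[R]_dimX :=
  \matrix_(i, j) coord e i (A e`_j).

Context {K : nat}.
Variables (L : 'rV[R]_K -> 'End(X)) (f : 'rV[R]_K -> X).

Definition truth_solution (G : set 'rV[R]_K) (u : 'rV[R]_K -> X) : Prop :=
  forall y, G y -> lker (L y) = 0%VS /\ L y (u y) = f y.

Context {Nrb : nat}.
Variables (nu : 'I_Nrb -> 'rV[R]_K) (u : 'rV[R]_K -> X).

Definition rb_space : {vspace X} := <<[seq u (nu k) | k : 'I_Nrb]>>%VS.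

Definition rb_combination (c : 'rV[R]_K -> 'I_Nrb -> R) (y : 'rV[R]_K) : X :=
  \sum_(k < Nrb) c y k *: u (nu k).

(* The projection may depend on the parameter: for least squares it is the
   orthogonal projection onto the image of the reduced space under L y. *)
Definition rb_coefficients (G : set 'rV[R]_K) (proj : 'rV[R]_K -> 'End(X))
    (c : 'rV[R]_K -> 'I_Nrb -> R) : Prop :=
  forall y, G y -> forall a : 'I_Nrb -> R,
    proj y (\sum_(k < Nrb) a k *: L y (u (nu k))) = proj y (f y) <-> a = c y.

Definition residual (uN : 'rV[R]_K -> X) (y : 'rV[R]_K) : X :=
  f y - L y (uN y).

(* RN y is the Riesz representation of the functional that the residual at y
   defines through the duality pairing.  With pairing := ip it is the residual
   itself; with the Euclidean product of the degrees of freedom it is the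
   representation of v |-> v^T r. *)
Definition riesz_residual (ip : {dot X for idfun}) (pairing : {biscalar X})
    (uN RN : 'rV[R]_K -> X) (G : set 'rV[R]_K) : Prop :=
  forall y, G y -> forall v, ip (RN y) v = pairing (residual uN y) v.

Definition stability_lower_bound (ip : {dot X for idfun})
    (e : dimX.-tuple X) (G : set 'rV[R]_K) (beta : 'rV[R]_K -> R) : Prop :=
  forall y, G y -> 0 < beta y /\
    forall v, v != 0 ->
      let A := op_matrix e (L y) in
      beta y <= ((dofs e v)^T *m A^T *m A *m dofs e v) 0 0 / hnorm ip v ^+ 2.

Definition a_posteriori (ip : {dot X for idfun}) (RN : 'rV[R]_K -> X)
    (beta : 'rV[R]_K -> R) (y : 'rV[R]_K) : R :=
  hnorm ip (RN y) / Num.sqrt (beta y).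

End Truth.

Section Constants.
Context {R : realType} {X : vectType R} {K M Q : nat}.
Variables (node : 'I_Q -> 'rV[R]_K) (w : 'I_Q -> R).

Definition weighted_estimate (Delta : 'rV[R]_K -> R) (q : 'I_Q) : R :=
  Delta (node q) * Num.sqrt (Q%:R * `|w q|).

Definition B_const (Phi : 'I_M -> 'rV[R]_K -> R) (m : 'I_M) : R :=
  Num.sqrt (\sum_(q < Q) `|w q| * Phi m (node q) ^+ 2).

Definition C_const (Phi : 'I_M -> 'rV[R]_K -> R)
    (F : quantity_of_interest X K) : R :=
  \sum_(m < M) B_const Phi m * `|qoi_scal F (Phi m)|.

End Constants.

(* Main.v *)
(** The projection of the reduced basis error on [Phi m] is a quadrature sum
    bounded, by the triangle and Cauchy-Schwarz inequalities, by [B_const] times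
    the square root of [sum_q |w_q| Delta(mu^q)^2]; this last sum is exactly
    [Q^-1 * sum_q (Deltaw q)^2].  The Lipschitz bound on [theta] and the triangle
    inequality over [m] then give the estimate. *)

Require Import Defs.
From HB Require Import structures.
From mathcomp Require Import all_boot all_order all_algebra.
From mathcomp Require Import all_classical all_reals all_analysis.
From mathcomp Require Import ring lra.

Set Implicit Arguments.
Unset Strict Implicit.
Unset Printing Implicit Defensive.

Import Order.TTheory GRing.Theory Num.Theory.
Local Open Scope classical_set_scope.
Local Open Scope ring_scope.

(** At [(b, - c)] the form equals [b * (a * b - c ^+ 2)], which settles [b > 0]. Stating this for
    abstract coefficients gives Cauchy-Schwarz both for finite sums and for [ip]. *)
Lemma psd_binary_form_discr (R : realFieldType) (a b c : R) :
  (forall s t, 0 <= s ^+ 2 * a + 2 * (s * t * c) + t ^+ 2 * b) ->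
  c ^+ 2 <= a * b.
Proof.
move=> psd; have b_ge0 : 0 <= b by have := psd 0 1; lra.
have [b0|b_neq0] := eqVneq b 0.
  (* With [b = 0] the form is affine in [t]; this [t] makes it equal [- c ^+ 2] at [s = c], forcing
     [c = 0]. *)
  have := psd c (- ((a + 1) / 2)); rewrite b0.
  have -> : c ^+ 2 * a + 2 * (c * - ((a + 1) / 2) * c) +
            (- ((a + 1) / 2)) ^+ 2 * 0 = - c ^+ 2 by field.
  by rewrite oppr_ge0 mulr0.
have b_gt0 : 0 < b by rewrite lt_def b_neq0.
have := psd b (- c).
have -> : b ^+ 2 * a + 2 * (b * - c * c) + (- c) ^+ 2 * b =
          b * (a * b - c ^+ 2) by ring.
by rewrite pmulr_rge0 // subr_ge0.
Qed.

(** The relevant binary form is a sum of the squares of [s * a i + t * b i], hence nonnegative. *)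
Lemma sum_CauchySchwarz (R : rcfType) (I : finType) (a b : I -> R) :
  \sum_i a i * b i <=
    Num.sqrt (\sum_i a i ^+ 2) * Num.sqrt (\sum_i b i ^+ 2).
Proof.
rewrite -sqrtrM; last by apply: sumr_ge0 => i _; exact: sqr_ge0.
apply: le_trans (ler_norm _) _; rewrite -sqrtr_sqr; apply: ler_wsqrtr.
apply: psd_binary_form_discr => s t.
have -> : s ^+ 2 * (\sum_i a i ^+ 2) + 2 * (s * t * \sum_i a i * b i) +
          t ^+ 2 * (\sum_i b i ^+ 2) = \sum_i (s * a i + t * b i) ^+ 2.
  by rewrite !mulr_sumr -!big_split /=; apply: eq_bigr => i _; ring.
by apply: sumr_ge0 => i _; exact: sqr_ge0.
Qed.

Section DotNorm.
Variables (R : realType) (X : vectType R) (ip : {dot X for idfun}).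

Lemma dot_ge0 v : 0 <= ip v v.
Proof.
have [->|v0] := eqVneq v 0; first by rewrite linear0l.
by rewrite ltW // neq0_dnorm_gt0.
Qed.

Lemma dotC u v : ip u v = ip v u.
Proof. by rewrite hermC expr0 mul1r. Qed.

(** Used with general [s], [t] for Cauchy-Schwarz and with [s = t = 1] for the triangle
    inequality. *)
Lemma dot_lincomb s t u v :
  ip (s *: u + t *: v) (s *: u + t *: v) =
  s ^+ 2 * ip u u + 2 * (s * t * ip u v) + t ^+ 2 * ip v v.
Proof.
rewrite linearDl !(linearDr ip) !(linearZl_LR ip) !(linearZr_LR ip) /=.
by rewrite (dotC v u); ring.
Qed.

Lemma hnorm_ge0 v : 0 <= hnorm ip v.
Proof. exact: sqrtr_ge0. Qed.

Lemma hnorm0 : hnorm ip 0 = 0.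
Proof. by rewrite /hnorm linear0l sqrtr0. Qed.

Lemma hnormZ a v : hnorm ip (a *: v) = `|a| * hnorm ip v.
Proof.
rewrite /hnorm (linearZl_LR ip) (linearZr_LR ip) /= mulrA -expr2.
by rewrite sqrtrM ?sqr_ge0 // sqrtr_sqr.
Qed.

Lemma hnormB_sym u v : hnorm ip (u - v) = hnorm ip (v - u).
Proof. by rewrite -opprB -scaleN1r hnormZ normrN1 mul1r. Qed.

Lemma ler_hnormD u v : hnorm ip (u + v) <= hnorm ip u + hnorm ip v.
Proof.
have cs : ip u v <= hnorm ip u * hnorm ip v.
  rewrite /hnorm -sqrtrM ?dot_ge0 //.
  apply: le_trans (ler_norm _) _; rewrite -sqrtr_sqr; apply: ler_wsqrtr.
  by apply: psd_binary_form_discr => s t; rewrite -dot_lincomb dot_ge0.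
(* Both sides are nonnegative, so their squares are compared; after cancellation only twice [cs]
   remains. *)
rewrite -ler_sqr ?nnegrE ?addr_ge0 ?hnorm_ge0 // sqrrD.
rewrite /hnorm !sqr_sqrtr ?dot_ge0 //.
have := dot_lincomb 1 1 u v; rewrite !scale1r => ->.
by move: cs; rewrite /hnorm; lra.
Qed.

Lemma ler_hnorm_sum (I : finType) (v : I -> X) :
  hnorm ip (\sum_i v i) <= \sum_i hnorm ip (v i).
Proof.
elim/big_ind2: _ => [|x a y b xa yb|//]; first by rewrite hnorm0.
exact: le_trans (ler_hnormD _ _) (lerD xa yb).
Qed.

Lemma gpc_coefB (K M Q : nat) (node : 'I_Q -> 'rV[R]_K) (w : 'I_Q -> R)
    (Phi : 'I_M -> 'rV[R]_K -> R) (u v : 'rV[R]_K -> X) m :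
  gpc_coef node w Phi u m - gpc_coef node w Phi v m =
  gpc_coef node w Phi (u \- v) m.
Proof. by rewrite -sumrB; apply: eq_bigr => q _; rewrite -scalerBr. Qed.

Lemma mean_weighted_estimate (K Q : nat) (node : 'I_Q -> 'rV[R]_K)
    (w : 'I_Q -> R) (Delta : 'rV[R]_K -> R) : (0 < Q)%N ->
  Q%:R^-1 * \sum_(q < Q) weighted_estimate node w Delta q ^+ 2 =
  \sum_(q < Q) `|w q| * Delta (node q) ^+ 2.
Proof.
move=> Q_gt0; rewrite mulr_sumr; apply: eq_bigr => q _.
rewrite exprMn sqr_sqrtr ?mulr_ge0 //.
(* The factor [Q] under the root in [weighted_estimate] cancels [Q%:R^-1]; this is where [Q_gt0]
   enters. *)
by field; rewrite pnatr_eq0 -lt0n.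
Qed.

Lemma hnorm_gpc_coef (K M Q : nat) (node : 'I_Q -> 'rV[R]_K) (w : 'I_Q -> R)
    (Phi : 'I_M -> 'rV[R]_K -> R) (v : 'rV[R]_K -> X)
    (Delta : 'rV[R]_K -> R) m : (0 < Q)%N ->
  (forall q, hnorm ip (v (node q)) <= Delta (node q)) ->
  hnorm ip (gpc_coef node w Phi v m) <=
  B_const node w Phi m *
  Num.sqrt (Q%:R^-1 * \sum_(q < Q) weighted_estimate node w Delta q ^+ 2).
Proof.
move=> Q_gt0 vD; rewrite mean_weighted_estimate //.
apply: le_trans (ler_hnorm_sum _) _.
(* Weights may be negative, so it is [|w q|] that is split into two equal roots: one goes with
   [Phi m] to form [B_const], the other with [Delta]. *)
apply: (@le_trans _ _ (\sum_(q < Q) (Num.sqrt `|w q| * `|Phi m (node q)|) *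
                         (Num.sqrt `|w q| * Delta (node q)))).
  apply: ler_sum => q _; rewrite hnormZ normrM mulrACA -expr2 sqr_sqrtr //.
  by rewrite -mulrA !ler_wpM2l.
apply: le_trans (sum_CauchySchwarz _ _) _.
under eq_bigr do rewrite exprMn sqr_sqrtr // real_normK ?num_real //.
by under [X in _ * Num.sqrt X]eq_bigr do rewrite exprMn sqr_sqrtr //.
Qed.

End DotNorm.

Theorem theorem3
  (R : realType)
  (* random parameters *)
  (disp : measure_display) (Omega : measurableType disp)
  (Pr : probability Omega R)
  (K : nat) (K_gt0 : (0 < K)%N)
  (mu : 'I_K -> {RV Pr >-> R})
  (mu_indep : mutually_independent mu)
  (rho : 'I_K -> R -> R)
  (mu_density : forall i, has_density mu i (rho i))
  (mu_moments : forall i, finite_moments mu i)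
  (* gPC basis *)
  (phi : 'I_K -> nat -> {poly R})
  (phi_orthonormal : forall i, orthonormal_polys (rho i) (phi i))
  (p : nat)
  (alpha : 'I_('C(K + p, K)) -> {ffun 'I_K -> nat})
  (alpha_enum : graded_enumeration p alpha)
  (* quadrature rule *)
  (Q : nat) (Q_gt0 : (0 < Q)%N)
  (node : 'I_Q -> 'rV[R]_K) (w : 'I_Q -> R)
  (node_in : forall q, param_domain mu (node q))
  (* truth space, with its inner product and degrees of freedom *)
  (dimX : nat) (X : vectType R) (ip : {dot X for idfun})
  (e : dimX.-tuple X) (e_basis : basis_of fullv e)
  (* truth solution *)
  (L : 'rV[R]_K -> 'End(X)) (f : 'rV[R]_K -> X) (u : 'rV[R]_K -> X)
  (u_truth : truth_solution L f (param_domain mu) u)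
  (* reduced basis approximation *)
  (Nrb : nat) (nu : 'I_Nrb -> 'rV[R]_K)
  (nu_train : forall k, exists q, nu k = node q)
  (rb_dim : (\dim (rb_space nu u) = Nrb)%N)
  (proj : 'rV[R]_K -> 'End(X))
  (proj_idem : forall y, param_domain mu y ->
     forall v, proj y (proj y v) = proj y v)
  (c : 'rV[R]_K -> 'I_Nrb -> R)
  (c_coef : rb_coefficients L f nu u (param_domain mu) proj c)
  (* a posteriori estimate *)
  (pairing : {biscalar X})
  (pairing_nondeg : forall r, (forall v, pairing r v = 0) -> r = 0)
  (RN : 'rV[R]_K -> X)
  (RN_riesz : riesz_residual L f ip pairing (rb_combination nu u c) RN
                (param_domain mu))
  (beta : 'rV[R]_K -> R)
  (beta_lb : stability_lower_bound L ip e (param_domain mu) beta)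
  (Delta_rigorous : forall q,
     hnorm ip (u (node q) - rb_combination nu u c (node q))
       <= a_posteriori ip RN beta (node q))
  (* quantity of interest *)
  (F : quantity_of_interest X K)
  (V : set X) (theta : X -> X) (CLip : R) :
  let Phi := gpc_basis phi alpha in
  let uN := rb_combination nu u c in
  let uhat := gpc_coef node w Phi u in
  let uNhat := gpc_coef node w Phi uN in
  let Deltaw := weighted_estimate node w (a_posteriori ip RN beta) in
  (forall m, V (uhat m)) ->
  (forall m, V (uNhat m)) ->
  (forall v, (forall m, V (v m)) ->
     qoi_vec F (gpc_expansion Phi v) =
     \sum_(m < 'C(K + p, K)) qoi_scal F (Phi m) *: theta (v m)) ->
  0 <= CLip ->
  (forall v v', V v -> V v' ->
     hnorm ip (theta v - theta v') <= CLip * hnorm ip (v - v')) ->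
  hnorm ip (qoi_vec F (gpc_expansion Phi uNhat) -
            qoi_vec F (gpc_expansion Phi uhat))
  <= CLip * C_const node w Phi F *
     Num.sqrt (Q%:R^-1 * \sum_(q < Q) Deltaw q ^+ 2).
Proof.
move=> Phi uN uhat uNhat Deltaw Vu VuN qoiE CLip_ge0 theta_lip.
rewrite !qoiE // -sumrB.
apply: le_trans (ler_hnorm_sum _ _) _.
rewrite -mulrA /C_const mulr_suml mulr_sumr; apply: ler_sum => m _.
(* The common factor, the absolute value of [qoi_scal F (Phi m)], is removed from both sides,
   leaving a bound on the increment of [theta]. *)
rewrite -scalerBr hnormZ mulrAC mulrA mulrC ler_wpM2r //.
apply: le_trans (theta_lip _ _ (VuN m) (Vu m)) _; rewrite ler_wpM2l //.
(* By linearity of the quadrature, the difference of coefficients is the coefficient of the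
   pointwise error [uN \- u]. *)
rewrite gpc_coefB; apply: hnorm_gpc_coef => // q.
(* [Delta_rigorous] bounds the error with the opposite sign. *)
by rewrite /= hnormB_sym.
Qed.
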